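(* For every integer $x\ge 0$, $$S_{3,0}(x)=3S_{3,0}\Big(\Big\lfloor\frac{x}{4}\Big\rfloor\Big)+\Delta_3(x)-(-1)^{s_2(\lfloor x/4\rfloor-1)}A_3(x),$$ where $A_3(x)=0$ if $x\equiv 0,1,2,3\pmod 8$ and $A_3(x)=1$ if $x\equiv 4,5,6,7\pmod 8$ (so the last term is $0$ whenever $\lfloor x/4\rfloor=0$), and $$\Delta_3(x)=\begin{cases}(-1)^{s_2(x-1)}, & x\equiv 1,7,10 \pmod{12},\\ (-1)^{s_2(x-2)}, & x\equiv 2,11\pmod{12},\\ (-1)^{s_2(x-3)}, & x\equiv 3\pmod{12},\\ 0, & \text{otherwise}.\end{cases}$$
   Context: For an integer $b\ge 2$ and integer $r\ge 0$, $s_b(r)$ denotes the sum of the digits of $r$ in base $b$. For integers $x\ge 0$, define $$S_{3,0}(x)=\sum_{0\le r<x,\; r\equiv 0 \pmod 3}(-1)^{s_{2}(r)}.$$ *)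

(* Defs.v *)
From HB Require Import structures.
From mathcomp Require Import all_boot all_order all_algebra.

Set Implicit Arguments.
Unset Strict Implicit.
Unset Printing Implicit Defensive.

Import GRing.Theory.
Local Open Scope ring_scope.

(* (r %/ b ^ i) %% b is the i-th base-b digit of r; for b >= 2 it vanishes
   when i >= r, because then b ^ i > i >= r. *)
Definition digit_sum (b r : nat) : nat := (\sum_(i < r) (r %/ b ^ i) %% b)%N.

Definition S30 (x : nat) : int :=
  \sum_(0 <= r < x | (r == 0 %[mod 3])%N) (-1) ^+ digit_sum 2 r.

Definition A3 (x : nat) : int :=
  if (x %% 8 \in [:: 0; 1; 2; 3])%N then 0 else 1.

(* In each nonzero case x is at least the number subtracted from it, so the
   truncated subtraction is the integer one. *)
Definition Delta3 (x : nat) : int :=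
  if (x %% 12 \in [:: 1; 7; 10])%N then (-1) ^+ digit_sum 2 (x - 1)
  else if (x %% 12 \in [:: 2; 11])%N then (-1) ^+ digit_sum 2 (x - 2)
  else if (x %% 12 == 3)%N then (-1) ^+ digit_sum 2 (x - 3)
  else 0.

(* Main.v *)
(** Write t n = (-1)^(s_2 n).  Splitting off the two lowest binary digits gives
    t (4n + i) = t i * t n for i < 4, so the block 4n, ..., 4n + 3 contributes
    3 t n - t n to S_{3,0} when 3 divides n and - t n otherwise.  The sum of t
    over [0, n) collapses because t (2m) + t (2m + 1) = 0, and this gives
    S_{3,0}(4n); Delta_3 is the contribution of the last, incomplete block. *)
Require Import Defs.
From mathcomp Require Import all_boot all_order all_algebra.
From mathcomp Require Import zify ring.

Set Implicit Arguments.
Unset Strict Implicit.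
Unset Printing Implicit Defensive.

Import GRing.Theory.
Local Open Scope ring_scope.

Lemma big_nat_ord_addl [R : Type] (idx : R) (op : R -> R -> R) (m k : nat)
    (P : pred nat) (F : nat -> R) :
  \big[op/idx]_(m <= i < m + k | P i) F i =
  \big[op/idx]_(i < k | P (m + i)%N) F (m + i)%N.
Proof.
rewrite -{1}[m]add0n big_addn addKn big_mkord.
by apply: eq_big => [i | i _]; rewrite addnC.
Qed.

Lemma digit_sum_ltn_exp (b r k : nat) : (1 < b)%N -> (r < b ^ k)%N ->
  digit_sum b r = (\sum_(i < k) (r %/ b ^ i) %% b)%N.
Proof.
move=> b_gt1 lt_r_bk.
have sum_digits_widen (l m : nat) : (r < b ^ l)%N -> (l <= m)%N ->
    (\sum_(i < l) (r %/ b ^ i) %% b = \sum_(i < m) (r %/ b ^ i) %% b)%N.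
  move=> lt_r_bl le_lm.
  rewrite (big_ord_widen m (fun i => (r %/ b ^ i) %% b)%N le_lm) big_mkcond.
  apply: eq_bigr => i _; case: ltnP => // le_li.
  by rewrite divn_small ?mod0n // (leq_trans lt_r_bl) // leq_exp2l.
have [le_rk | /ltnW le_kr] := leqP r k.
  exact/sum_digits_widen/le_rk/ltn_expl.
exact/esym/sum_digits_widen.
Qed.

Lemma digit_sum_mul_expD (b k n a : nat) : (1 < b)%N -> (a < b ^ k)%N ->
  digit_sum b (n * b ^ k + a) = (digit_sum b n + digit_sum b a)%N.
Proof.
move=> b_gt1 lt_a_bk; have exp_gt0 e : (0 < b ^ e)%N by rewrite expn_gt0 ltnW.
have lt_n_bn : (n < b ^ n)%N by apply: ltn_expl.
have lt_r : (n * b ^ k + a < b ^ (k + n))%N.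
  rewrite [(k + n)%N]addnC expnD -ltn_divLR //.
  by rewrite divnMDl // divn_small // addn0.
rewrite (digit_sum_ltn_exp b_gt1 lt_r) big_split_ord [RHS]addnC /=.
rewrite (digit_sum_ltn_exp b_gt1 lt_n_bn) (digit_sum_ltn_exp b_gt1 lt_a_bk).
congr (_ + _)%N; apply: eq_bigr => i _.
- rewrite (_ : n * b ^ k = n * b ^ (k - i.+1) * b * b ^ i)%N.
    by rewrite divnMDl // modnMDl.
  by rewrite -!mulnA -expnS -expnD subnK.
- by rewrite expnD divnMA divnMDl // (divn_small lt_a_bk) addn0.
Qed.

Definition thue_morse (n : nat) : int := (-1) ^+ digit_sum 2 n.

Lemma thue_morse_mul_expD (k n a : nat) : (a < 2 ^ k)%N ->
  thue_morse (n * 2 ^ k + a) = thue_morse n * thue_morse a.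
Proof. by move=> lt_a; rewrite /thue_morse digit_sum_mul_expD // exprD. Qed.

Lemma thue_morse0 : thue_morse 0 = 1.
Proof. by rewrite /thue_morse /digit_sum big_ord0. Qed.

Lemma thue_morse1 : thue_morse 1 = -1.
Proof. by rewrite /thue_morse /digit_sum big_ord1. Qed.

Lemma thue_morse2 : thue_morse 2 = -1.
Proof.
by rewrite (@thue_morse_mul_expD 1 1 0) // thue_morse1 thue_morse0 mulr1.
Qed.

Lemma thue_morse3 : thue_morse 3 = 1.
Proof.
by rewrite (@thue_morse_mul_expD 1 1 1) // thue_morse1 mulrNN mulr1.
Qed.

Lemma thue_morse_evenS (n : nat) : ~~ odd n -> thue_morse n.+1 = - thue_morse n.
Proof.
move=> even_n; rewrite -(even_halfK even_n) -muln2.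
rewrite -addn1 (@thue_morse_mul_expD 1) //.
rewrite -[(_ * 2)%N]addn0 (@thue_morse_mul_expD 1) //.
by rewrite thue_morse0 thue_morse1 mulr1 mulrN1.
Qed.

Lemma sum_thue_morse (n : nat) :
  \sum_(0 <= r < n) thue_morse r = thue_morse n.-1 *+ odd n.
Proof.
elim: n => [|n IHn]; first by rewrite big_geq.
rewrite big_nat_recr // IHn.
case: n {IHn} => [|n] /=; first by rewrite add0r.
have [odd_n | even_n] := boolP (odd n); first by rewrite add0r.
by rewrite (thue_morse_evenS even_n) subrr.
Qed.

Lemma modn3_mul4D (n i : nat) : ((n * 4 + i) %% 3 = (n %% 3 + i) %% 3)%N.
Proof. lia. Qed.

Lemma sum_dvd3_block4 (n : nat) :
  \sum_(n * 4 <= r < n.+1 * 4 | (r %% 3 == 0)%N) thue_morse r =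
  (if (n %% 3 == 0)%N then 3 * thue_morse n else 0) - thue_morse n.
Proof.
rewrite mulSn addnC big_nat_ord_addl.
under eq_bigl => i do rewrite modn3_mul4D.
under eq_bigr => i _ do rewrite (@thue_morse_mul_expD 2) //.
rewrite -big_distrr /= big_mkcond !big_ord_recl big_ord0.
rewrite /= thue_morse0 thue_morse1 thue_morse2 thue_morse3.
have : (n %% 3 < 3)%N by rewrite ltn_mod.
by case: (n %% 3)%N => [|[|[|//]]] _ /=; ring.
Qed.

Lemma S30_mul4 (n : nat) :
  S30 (n * 4) = 3 * S30 n - thue_morse n.-1 *+ odd n.
Proof.
rewrite -sum_thue_morse /S30 !(big_mkcond (fun r => r %% 3 == 0)%N).
rewrite big_nat_mul big_distrr -sumrB; apply: eq_bigr => m _.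
by rewrite -big_mkcond /= sum_dvd3_block4; case: ifP; rewrite ?mulr0.
Qed.

Lemma Delta3_mul4D (n j : nat) : (j < 4)%N ->
  Delta3 (n * 4 + j) =
  \sum_(n * 4 <= r < n * 4 + j | (r %% 3 == 0)%N) thue_morse r.
Proof.
move=> lt_j4; rewrite big_nat_ord_addl /Delta3 -!/(thue_morse _).
under eq_bigl => i do rewrite modn3_mul4D.
rewrite big_mkcond.
have -> : ((n * 4 + j) %% 12 = n %% 3 * 4 + j)%N by lia.
(* At most one of 4n, 4n + 1, 4n + 2 is divisible by 3; n mod 3 tells which. *)
have : (n %% 3 < 3)%N by rewrite ltn_mod.
by case: j lt_j4 => [|[|[|[|//]]]] _; rewrite ?big_ord_recl big_ord0;
  case: (n %% 3)%N => [|[|[|//]]] _ /=; rewrite -?addnBA // ?add0r ?addr0.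
Qed.

Lemma S30_mul4D (n j : nat) : (j < 4)%N ->
  S30 (n * 4 + j) = S30 (n * 4) + Delta3 (n * 4 + j).
Proof. by move=> lt_j4; rewrite Delta3_mul4D // -big_cat_nat ?leq_addr. Qed.

Lemma A3_odd_div4 (x : nat) : A3 x = (odd (x %/ 4))%:R.
Proof.
rewrite /A3 (_ : x %% 8 = odd (x %/ 4) * 4 + x %% 4)%N; last by lia.
have : (x %% 4 < 4)%N by rewrite ltn_mod.
by case: (odd _); case: (x %% 4)%N => [|[|[|[|//]]]].
Qed.

Theorem theorem3 (x : nat) :
  S30 x = 3 * S30 (x %/ 4)%N + Delta3 x
          - (-1) ^+ digit_sum 2 (x %/ 4 - 1)%N * A3 x.
Proof.
have S30_x : S30 x = S30 (x %/ 4 * 4) + Delta3 x.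
  by rewrite {1 3}(divn_eq x 4) S30_mul4D // ltn_mod.
rewrite S30_x S30_mul4 -/(thue_morse _) A3_odd_div4 subn1 mulr_natr.
exact: addrAC.
Qed.
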